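(* Let $0<q<1$, let $a$ and $b$ be positive odd integers, let $s\in\mathbb{C}$, and let $x\in\mathbb{C}$ be such that all values of $\widetilde{\zeta}$ appearing below are defined. Then $$\frac{[2]_{q^{b}}}{[a]_{q}^{s}}\sum_{i=0}^{a-1}(-1)^{i}q^{ib(1-s)}\,\widetilde{\zeta}_{q^{a}}\!\left(s,\;q^{-a}\left[bx+\frac{bi}{a}\right]_{q^{-a}}\right)=\frac{[2]_{q^{a}}}{[b]_{q}^{s}}\sum_{i=0}^{b-1}(-1)^{i}q^{ia(1-s)}\,\widetilde{\zeta}_{q^{b}}\!\left(s,\;q^{-b}\left[ax+\frac{ai}{b}\right]_{q^{-b}}\right).$$
   Context: For a positive real $p\neq 1$ and $\lambda\in\mathbb{C}$, the $p$-number is $[\lambda]_{p}:=\frac{1-p^{\lambda}}{1-p}$, where $p^{\lambda}=e^{\lambda\log p}$ with $\log p$ real (this is used both for bases in $(0,1)$ such as $q, q^a, q^b$ and for bases $>1$ such as $q^{-a},q^{-b}$). The notation $[a]_q^s$ means $([a]_q)^s$. For $0<q<1$, the $q$-Zeta type function is $$\widetilde{\zeta}_{q}(s,x):=[2]_{q}\sum_{n=0}^{\infty}\frac{(-1)^{n}q^{n}}{\left(x+[n]_{q}\right)^{s}},$$ for $s\in\mathbb{C}$ and $x\in\mathbb{C}$ with $x\neq-[n]_{q}$ for all $n\in\{0,1,2,\dots\}$. Complex powers are principal-branch powers. The functions $\widetilde{\zeta}_{q^{a}}$ and $\widetilde{\zeta}_{q^{b}}$ are obtained by replacing $q$ by $q^{a}$,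 respectively $q^{b}$, throughout the definition. ''Defined'' means that the second argument $y$ of each $\widetilde{\zeta}_{q^a}(s,y)$ (resp. $\widetilde{\zeta}_{q^b}(s,y)$) satisfies $y\neq-[n]_{q^a}$ (resp. $y\neq-[n]_{q^b}$) for all integers $n\geq 0$. *)

(* Defs.v *)
From Stdlib Require Export Reals Lra.
From Coquelicot Require Export Coquelicot.

Open Scope R_scope.
Open Scope C_scope.

Definition Cexp (z : C) : C :=
  RtoC (exp (Re z)) * (cos (Im z), sin (Im z)).

(* Principal argument, with values in (-PI, PI]; its value at 0 is irrelevant. *)
Definition Carg (z : C) : R :=
  if Rle_dec 0 (Im z) then acos (Re z / Cmod z) else (- acos (Re z / Cmod z))%R.

Definition Clog (z : C) : C := (ln (Cmod z), Carg z).

(* Principal branch of z ^ s for z <> 0; its value at z = 0 is irrelevant.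
   Coquelicot's [Cpow] is the power with a natural exponent. *)
Definition Ccpow (z s : C) : C := Cexp (s * Clog z).

(* p ^ l for a real base p > 0, with the real logarithm of p. *)
Definition Rcpow (p : R) (l : C) : C := Cexp (l * RtoC (ln p)).

Definition pnum (p : R) (l : C) : C := (1 - Rcpow p l) / (1 - RtoC p).

(* As for [RInt], the sum is obtained from [is_series] by definite description,
   and is meaningful for convergent series only. *)
Definition CSeries (u : nat -> C) : C :=
  iota (T := C_CompleteNormedModule)
    (is_series (K := C_AbsRing) (V := C_NormedModule) u).

Definition qzeta (q : R) (s x : C) : C :=
  pnum q 2 *
  CSeries (fun n => RtoC ((-1) ^ n * q ^ n) / Ccpow (x + pnum q (INR n)) s).

Definition qzeta_defined (q : R) (x : C) : Prop :=
  forall n : nat, x <> - pnum q (INR n).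

(* The second argument q^(-a) [b x + b i / a]_(q^(-a)) of the q-zeta function
   of base q^a. *)
Definition qzeta_arg (q : R) (a b i : nat) (x : C) : C :=
  RtoC (/ q ^ a) * pnum (/ q ^ a) (INR b * x + INR b * INR i / INR a).

Lemma Carg_bound (z : C) : z <> 0 -> (- PI < Carg z <= PI)%R.
Proof.
intros Hz.
assert (Hm : (0 < Cmod z)%R) by now apply Cmod_gt_0.
pose proof PI_RGT_0.
pose proof (acos_bound (Re z / Cmod z)).
unfold Carg; destruct (Rle_dec 0 (Im z)) as [Hi|Hi]; [lra|].
enough (acos (Re z / Cmod z) <> PI) by lra.
intros Heq.
assert (Hr : (-1 <= Re z / Cmod z <= 1)%R).
{ apply Rabs_le_between. unfold Rdiv.
  rewrite Rabs_mult, Rabs_inv, (Rabs_pos_eq (Cmod z)) by lra.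
  apply (Rmult_le_reg_r (Cmod z)); [lra|].
  rewrite Rmult_assoc, Rinv_l, Rmult_1_r, Rmult_1_l by lra.
  apply re_le_Cmod. }
assert (Hc : (Re z / Cmod z = -1)%R).
{ rewrite <- (cos_acos _ Hr), Heq. apply cos_PI. }
assert (Hre : (Re z = - Cmod z)%R).
{ replace (Re z) with (Re z / Cmod z * Cmod z)%R by (field; lra).
  rewrite Hc; ring. }
pose proof (Cmod2_alt z) as H2.
rewrite Hre in H2. nra.
Qed.

Lemma Cexp_Clog (z : C) : z <> 0 -> Cexp (Clog z) = z.
Proof.
intros Hz.
assert (Hm : (0 < Cmod z)%R) by now apply Cmod_gt_0.
assert (Hr : (-1 <= Re z / Cmod z <= 1)%R).
{ apply Rabs_le_between. unfold Rdiv.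
  rewrite Rabs_mult, Rabs_inv, (Rabs_pos_eq (Cmod z)) by lra.
  apply (Rmult_le_reg_r (Cmod z)); [lra|].
  rewrite Rmult_assoc, Rinv_l, Rmult_1_r, Rmult_1_l by lra.
  apply re_le_Cmod. }
assert (Hs : sqrt (1 - Rsqr (Re z / Cmod z)) = (Rabs (Im z) / Cmod z)%R).
{ rewrite <- (sqrt_Rsqr (Rabs (Im z) / Cmod z)).
  2:{ apply Rdiv_le_0_compat; [apply Rabs_pos|lra]. }
  f_equal. pose proof (Cmod2_alt z) as H2.
  unfold Rsqr.
  apply (Rmult_eq_reg_r (Cmod z ^ 2)%R); [|nra].
  replace ((1 - Re z / Cmod z * (Re z / Cmod z)) * Cmod z ^ 2)%R
    with (Cmod z ^ 2 - Re z ^ 2)%R by (field; lra).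
  replace (Rabs (Im z) / Cmod z * (Rabs (Im z) / Cmod z) * Cmod z ^ 2)%R
    with (Rabs (Im z) ^ 2)%R by (field; lra).
  rewrite pow2_abs. lra. }
unfold Cexp, Clog. simpl Re. simpl Im.
rewrite exp_ln by assumption.
assert (Hcos : (cos (Carg z) = Re z / Cmod z)%R).
{ unfold Carg; destruct (Rle_dec 0 (Im z)); rewrite ?cos_neg; now apply cos_acos. }
assert (Hsin : (sin (Carg z) = Im z / Cmod z)%R).
{ unfold Carg; destruct (Rle_dec 0 (Im z)); rewrite ?sin_neg, sin_acos, Hs by assumption.
  - rewrite Rabs_pos_eq by assumption. reflexivity.
  - rewrite Rabs_left by lra. field. lra. }
rewrite Hcos, Hsin.
destruct z as [u v]; unfold Cmult, RtoC; simpl Re; simpl Im; simpl fst; simpl snd.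
f_equal; field; lra.
Qed.

Lemma CSeries_unique (u : nat -> C) (l : C) :
  is_series (K := C_AbsRing) (V := C_NormedModule) u l -> CSeries u = l.
Proof.
intros H.
refine (iota_unique (K := C_AbsRing) (V := C_CompleteNormedModule)
  (is_series (K := C_AbsRing) (V := C_NormedModule) u) l _ H).
intros y Hy.
exact (filterlim_locally_unique (K := C_AbsRing) (V := C_NormedModule)
  (F := eventually) _ y l Hy H).
Qed.

(* Main.v *)
Require Import Defs.
From Stdlib Require Import Lia.

(** With [W = q ^ (- a b x)] a direct computation gives
    [q^(-a) [b x + b i / a]_(q^(-a)) + [n]_(q^a)
       = q^(- b i) / [a]_q * ((W - q^(a n + b i)) / (1 - q))].
    The factor in front is a positive real, so the principal power [_ ^ s]
    splits it off without any correction for the branch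
    ([Ccpow_scale_pos]).  It cancels [[a]_q ^ s] and the [s]-dependent part of
    the weight [q^(i b (1 - s))], and since [a] and [b] are odd the signs
    combine to [(-1)^i (-1)^n = (-1)^(a n + b i)].  Each summand thus becomes
    [[2]_(q^a)] times the series of [g (a n + b i)] over [n], where
    [g m = (- q)^m / ((W - q^m) / (1 - q))^s] depends on [a] and [b] only
    through the symmetric quantity [W] ([weighted_qzeta]).

    It remains to see that the sum over [i < a] and [n >= 0] of [g (a n + b i)]
    is symmetric in [a] and [b].  Splitting [n = b k + j] with [j < b] turns it
    into the sum over [i < a], [j < b], [k >= 0] of [g (a b k + a j + b i)]
    ([series_blocks], [double_sum_sym]).  All series involved converge because
    [W - q^m] tends to [W <> 0], so that the powers in [g] stay bounded and
    [q^m] dominates. *)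

(** * Complex exponentials and powers with positive real factors *)

Lemma Cexp_plus (u v : C) : Cexp (u + v) = Cexp u * Cexp v.
Proof.
destruct u as [u1 u2], v as [v1 v2].
unfold Cexp, Cplus, Cmult, RtoC; simpl.
rewrite exp_plus, cos_plus, sin_plus.
f_equal; ring.
Qed.

Lemma Cexp_RtoC (r : R) : Cexp (RtoC r) = RtoC (exp r).
Proof.
unfold Cexp, RtoC, Cmult; simpl.
rewrite cos_0, sin_0; f_equal; ring.
Qed.

Lemma Cmod_Cexp (z : C) : Cmod (Cexp z) = exp (Re z).
Proof.
unfold Cexp; rewrite Cmod_mult, Cmod_R, Rabs_pos_eq by apply Rlt_le, exp_pos.
replace (Cmod (cos (Im z), sin (Im z))) with 1%R; [ring|].
unfold Cmod; simpl fst; simpl snd.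
replace (cos (Im z) ^ 2 + sin (Im z) ^ 2)%R with 1%R; [now rewrite sqrt_1|].
generalize (sin2_cos2 (Im z)); unfold Rsqr; lra.
Qed.

Lemma Cexp_neq_0 (z : C) : Cexp z <> 0.
Proof.
apply Cmod_gt_0; rewrite Cmod_Cexp; apply exp_pos.
Qed.

Lemma Rcpow_plus (p : R) (u v : C) : Rcpow p (u + v) = Rcpow p u * Rcpow p v.
Proof.
unfold Rcpow; rewrite <- Cexp_plus; f_equal; ring.
Qed.

Lemma Rcpow_mult_base (p r : R) (u : C) :
  (0 < p)%R -> (0 < r)%R -> Rcpow (p * r) u = Rcpow p u * Rcpow r u.
Proof.
intros Hp Hr; unfold Rcpow.
rewrite <- Cexp_plus, ln_mult, RtoC_plus by assumption; f_equal; ring.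
Qed.

Lemma Rcpow_opp (p : R) (u : C) : Rcpow p (- u) = / Rcpow p u.
Proof.
assert (H : Rcpow p u * Rcpow p (- u) = 1).
{ rewrite <- Rcpow_plus, Cplus_opp_r.
  unfold Rcpow; rewrite Cmult_0_l, Cexp_RtoC, exp_0; reflexivity. }
assert (Hu := Cexp_neq_0 (u * RtoC (ln p)) : Rcpow p u <> 0).
replace (/ Rcpow p u) with (/ Rcpow p u * 1) by ring.
rewrite <- H; field; assumption.
Qed.

Lemma Rcpow_pow_base (p : R) (n : nat) (u : C) :
  (0 < p)%R -> Rcpow (p ^ n) u = Rcpow p (INR n * u).
Proof.
intros Hp; unfold Rcpow.
rewrite ln_pow, RtoC_mult by assumption; f_equal; ring.
Qed.

Lemma Rcpow_inv_base (p : R) (u : C) :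
  (0 < p)%R -> Rcpow (/ p) u = Rcpow p (- u).
Proof.
intros Hp; unfold Rcpow.
rewrite ln_Rinv, RtoC_opp by assumption; f_equal; ring.
Qed.

Lemma Rcpow_INR (p : R) (n : nat) :
  (0 < p)%R -> Rcpow p (INR n) = RtoC (p ^ n).
Proof.
intros Hp; unfold Rcpow.
rewrite <- RtoC_mult, Cexp_RtoC, <- ln_pow, exp_ln by auto using pow_lt.
reflexivity.
Qed.

Lemma pnum_INR (p : R) (n : nat) :
  (0 < p < 1)%R -> pnum p (INR n) = RtoC ((1 - p ^ n) / (1 - p)).
Proof.
intros Hp; unfold pnum.
rewrite Rcpow_INR, RtoC_div, !RtoC_minus by lra; reflexivity.
Qed.

(** Multiplication by a positive real changes the logarithm by [ln r] and
    leaves the argument alone, so no branch correction appears. *)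
Lemma Ccpow_scale_pos (r : R) (z s : C) :
  (0 < r)%R -> z <> 0 -> Ccpow (RtoC r * z) s = Rcpow r s * Ccpow z s.
Proof.
intros Hr Hz.
assert (Hm : (0 < Cmod z)%R) by now apply Cmod_gt_0.
unfold Ccpow, Rcpow; rewrite <- Cexp_plus; f_equal.
replace (Clog (RtoC r * z)) with (RtoC (ln r) + Clog z); [ring|].
assert (Hre : Re (RtoC r * z) = (r * Re z)%R) by (unfold Re, Im; simpl; ring).
assert (Him : Im (RtoC r * z) = (r * Im z)%R) by (unfold Re, Im; simpl; ring).
assert (Hmod : Cmod (RtoC r * z) = (r * Cmod z)%R)
  by (rewrite Cmod_mult, Cmod_R, Rabs_pos_eq by lra; reflexivity).
unfold Clog, Carg; rewrite Hre, Him, Hmod, ln_mult by assumption.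
replace (r * Re z / (r * Cmod z))%R with (Re z / Cmod z)%R by (field; lra).
unfold Cplus, RtoC; simpl fst; simpl snd; rewrite Rplus_0_l; f_equal.
destruct (Rle_dec 0 (Im z)), (Rle_dec 0 (r * Im z)); try reflexivity; nra.
Qed.

Lemma Ccpow_RtoC (r : R) (s : C) : (0 < r)%R -> Ccpow (RtoC r) s = Rcpow r s.
Proof.
intros Hr.
unfold Ccpow, Rcpow; do 2 f_equal.
unfold Clog, Carg; rewrite Cmod_R, Rabs_pos_eq by lra.
simpl Re; simpl Im.
destruct (Rle_dec 0 0); [|lra].
replace (r / r)%R with 1%R by (field; lra).
rewrite acos_1; reflexivity.
Qed.

(** * Splitting a series into residue classes *)

Lemma sum_n_Cmult_l (c : C) (u : nat -> C) (n : nat) :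
  sum_n (G := C_AbelianMonoid) (fun i => c * u i) n
  = c * sum_n (G := C_AbelianMonoid) u n.
Proof. exact (sum_n_mult_l (K := C_Ring) c u n). Qed.

Lemma sum_n_shift (u : nat -> C) (M n : nat) :
  sum_n (G := C_AbelianMonoid) u (M + S n)
  = sum_n (G := C_AbelianMonoid) u M
    + sum_n (G := C_AbelianMonoid) (fun j => u (S M + j)%nat) n.
Proof.
induction n as [|n IH].
- rewrite Nat.add_1_r, sum_Sn, sum_O, Nat.add_0_r; reflexivity.
- rewrite Nat.add_succ_r, !sum_Sn, IH.
  replace (S M + S n)%nat with (S (M + S n)) by lia.
  symmetry; apply Cplus_assoc.
Qed.

Lemma sum_n_blocks (u : nat -> C) (B N : nat) :
  sum_n (G := C_AbelianMonoid)
    (fun k => sum_n (G := C_AbelianMonoid) (fun j => u (S B * k + j)%nat) B) N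
  = sum_n (G := C_AbelianMonoid) u (S B * N + B).
Proof.
induction N as [|N IH].
- rewrite sum_O, Nat.mul_0_r; reflexivity.
- rewrite sum_Sn, IH.
  replace (S B * S N + B)%nat with (S B * N + B + S B)%nat by lia.
  rewrite sum_n_shift.
  apply f_equal, sum_n_ext; intros j; f_equal; lia.
Qed.

Lemma is_series_sum_n (u : nat -> nat -> C) (l : nat -> C) (B : nat) :
  (forall j, (j <= B)%nat ->
     is_series (K := C_AbsRing) (V := C_NormedModule) (u j) (l j)) ->
  is_series (K := C_AbsRing) (V := C_NormedModule)
    (fun k => sum_n (G := C_AbelianMonoid) (fun j => u j k) B)
    (sum_n (G := C_AbelianMonoid) l B).
Proof.
induction B as [|B IH]; intros H.
- rewrite sum_O.
  apply is_series_ext with (2 := H 0%nat (le_n _)).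
  intros k; now rewrite sum_O.
- rewrite sum_Sn.
  apply is_series_ext with (2 := is_series_plus _ _ _ _
    (IH (fun j Hj => H j (Nat.le_le_succ_r _ _ Hj))) (H (S B) (le_n _))).
  intros k; now rewrite sum_Sn.
Qed.

(** The partial sums of the block series are a subsequence of those of [u],
    so both series, being convergent, have the same sum. *)
Lemma series_blocks (u : nat -> C) (l : nat -> C) (L : C) (B : nat) :
  is_series (K := C_AbsRing) (V := C_NormedModule) u L ->
  (forall j, (j <= B)%nat ->
     is_series (K := C_AbsRing) (V := C_NormedModule)
       (fun k => u (S B * k + j)%nat) (l j)) ->
  L = sum_n (G := C_AbelianMonoid) l B.
Proof.
intros Hu Hl.
apply (is_series_sum_n (fun j k => u (S B * k + j)%nat)) in Hl.
assert (Hsub : is_series (K := C_AbsRing) (V := C_NormedModule)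
  (fun k => sum_n (G := C_AbelianMonoid) (fun j => u (S B * k + j)%nat) B) L).
{ apply filterlim_ext with (fun N =>
    sum_n (G := C_AbelianMonoid) u (S B * N + B)).
  - intros N; symmetry; apply sum_n_blocks.
  - refine (filterlim_comp _ _ _ (fun N => (S B * N + B)%nat) _ _ _ _ _ Hu).
    apply eventually_subseq; intros n; lia. }
now rewrite <- (CSeries_unique _ _ Hsub), <- (CSeries_unique _ _ Hl).
Qed.

(** Along [a n + b i], the blocks [n = b k + j] give the indices
    [a b k + a j + b i], an expression symmetric under exchanging [(a, i)] and
    [(b, j)]. *)
Lemma double_sum_sym (g : nat -> C) (a b : nat) :
  (0 < a)%nat -> (0 < b)%nat ->
  (forall d c, (0 < d)%nat ->
     ex_series (K := C_AbsRing) (V := C_NormedModule)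
       (fun n => g (d * n + c)%nat)) ->
  sum_n (G := C_AbelianMonoid)
    (fun i => CSeries (fun n => g (a * n + b * i)%nat)) (a - 1)
  = sum_n (G := C_AbelianMonoid)
    (fun j => CSeries (fun n => g (b * n + a * j)%nat)) (b - 1).
Proof.
intros Ha Hb Hg.
assert (Hsum : forall d c, (0 < d)%nat ->
  is_series (K := C_AbsRing) (V := C_NormedModule) (fun n => g (d * n + c)%nat)
    (CSeries (fun n => g (d * n + c)%nat))).
{ intros d c Hd; destruct (Hg d c Hd) as [l Hl].
  now rewrite (CSeries_unique _ _ Hl). }
assert (Hsplit : forall d e i, (0 < d)%nat -> (0 < e)%nat ->
  CSeries (fun n => g (d * n + e * i)%nat)
  = sum_n (G := C_AbelianMonoid)
      (fun j => CSeries (fun k => g (d * e * k + (d * j + e * i))%nat))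
      (e - 1)).
{ intros d e i Hd He.
  refine (series_blocks _ _ _ (e - 1) (Hsum d (e * i)%nat Hd) _).
  intros j _.
  refine (is_series_ext _ _ _ _ (Hsum (d * e)%nat (d * j + e * i)%nat _));
    [|lia].
  intros k; replace (S (e - 1)) with e by lia; f_equal; ring. }
erewrite sum_n_ext by (intros i; apply (Hsplit a b i Ha Hb)).
erewrite (sum_n_ext (fun j => CSeries (fun n => g (b * n + a * j)%nat)))
  by (intros j; apply (Hsplit b a j Hb Ha)).
rewrite sum_n_switch.
apply sum_n_ext; intros j; apply sum_n_ext; intros i.
rewrite (Nat.mul_comm b a), (Nat.add_comm (b * i)); reflexivity.
Qed.

(** * The alternating series behind both sides *)

Definition alt_term (q : R) (s W : C) (m : nat) : C :=
  RtoC ((- q) ^ m) / Ccpow ((W - RtoC (q ^ m)) / (1 - RtoC q)) s.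

Lemma is_lim_seq_Cmod_shift (q : R) (W : C) :
  (0 < q < 1)%R ->
  is_lim_seq (fun m => Cmod ((W - RtoC (q ^ m)) / (1 - RtoC q)))
    (Cmod W / (1 - q))%R.
Proof.
intros Hq.
assert (Hpow : is_lim_seq (fun m => (q ^ m)%R) 0%R)
  by (apply is_lim_seq_geom; rewrite Rabs_pos_eq; lra).
assert (Hmod : is_lim_seq (fun m => Cmod (W - RtoC (q ^ m))) (Cmod W)).
{ apply is_lim_seq_le_le
    with (fun m => (Cmod W - q ^ m)%R) (fun m => (Cmod W + q ^ m)%R).
  - intros m.
    assert (Hm : Cmod (RtoC (q ^ m)) = (q ^ m)%R)
      by (rewrite Cmod_R, Rabs_pos_eq; [reflexivity|apply pow_le; lra]).
    split.
    + assert (T := Cmod_triangle (W - RtoC (q ^ m)) (RtoC (q ^ m))).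
      replace (W - RtoC (q ^ m) + RtoC (q ^ m)) with W in T by ring.
      rewrite Hm in T; lra.
    + rewrite <- Hm at 2; rewrite <- (Cmod_opp (RtoC _)).
      apply Cmod_triangle.
  - replace (Finite (Cmod W)) with (Finite (Cmod W - 0)) by (f_equal; ring).
    apply is_lim_seq_minus'; [apply is_lim_seq_const|exact Hpow].
  - replace (Finite (Cmod W)) with (Finite (Cmod W + 0)) by (f_equal; ring).
    apply is_lim_seq_plus'; [apply is_lim_seq_const|exact Hpow]. }
apply is_lim_seq_ext with (fun m => (Cmod (W - RtoC (q ^ m)) * / (1 - q))%R).
- intros m; rewrite <- RtoC_minus, Cmod_div, Cmod_R, Rabs_pos_eq by
    (try (intros H; apply RtoC_inj in H); lra).
  reflexivity.
- apply (is_lim_seq_scal_r _ (/ (1 - q)) (Finite (Cmod W))); exact Hmod.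
Qed.

Lemma Carg_abs_le (z : C) : (Rabs (Carg z) <= PI)%R.
Proof.
assert (B := acos_bound (Re z / Cmod z)).
apply Rabs_le; unfold Carg; destruct (Rle_dec 0 (Im z)); lra.
Qed.

(** The logarithm of the modulus of the base converges, hence is bounded, and
    the argument is bounded on the whole plane.  Bounding the two parts
    separately covers the case of [W] on the branch cut, where the powers
    themselves need not converge to the power of the limit. *)
Lemma alt_term_bound (q : R) (s W : C) :
  (0 < q < 1)%R -> W <> 0 ->
  exists K : R, (0 <= K)%R /\ forall m, (Cmod (alt_term q s W m) <= K * q ^ m)%R.
Proof.
intros Hq HW.
assert (HW' : (0 < Cmod W / (1 - q))%R).
{ apply Rdiv_lt_0_compat; [now apply Cmod_gt_0|lra]. }
destruct (filterlim_bounded (K := R_AbsRing) (V := R_NormedModule)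
  (fun m => ln (Cmod ((W - RtoC (q ^ m)) / (1 - RtoC q))))) as [M HM].
{ exists (ln (Cmod W / (1 - q))).
  apply (is_lim_seq_continuous ln _ (Cmod W / (1 - q))).
  - apply continuity_pt_filterlim, continuous_ln, HW'.
  - now apply is_lim_seq_Cmod_shift. }
exists (exp (Rabs (Re s) * M + Rabs (Im s) * PI)).
split; [apply Rlt_le, exp_pos|]; intros m.
specialize (HM m).
unfold alt_term.
rewrite Cmod_div by apply Cexp_neq_0.
unfold Ccpow; set (z := (W - RtoC (q ^ m)) / (1 - RtoC q)) in *.
rewrite Cmod_R, <- RPow_abs, Rabs_Ropp, Rabs_pos_eq by lra.
rewrite Cmod_Cexp; unfold Rdiv; rewrite (Rmult_comm (q ^ m)).
apply Rmult_le_compat_r; [apply pow_le; lra|].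
rewrite <- exp_Ropp.
assert (exp_le : forall u v : R, (u <= v)%R -> (exp u <= exp v)%R).
{ intros u v [H | ->]; [now apply Rlt_le, exp_increasing|apply Rle_refl]. }
apply exp_le.
replace (Re (s * Clog z)) with (Re s * ln (Cmod z) - Im s * Carg z)%R
  by reflexivity.
change (Rabs (ln (Cmod z)) <= M)%R in HM.
assert (A := Carg_abs_le z).
assert (H1 : (Rabs (Re s * ln (Cmod z)) <= Rabs (Re s) * M)%R)
  by (rewrite Rabs_mult; apply Rmult_le_compat_l; [apply Rabs_pos|exact HM]).
assert (H2 : (Rabs (Im s * Carg z) <= Rabs (Im s) * PI)%R)
  by (rewrite Rabs_mult; apply Rmult_le_compat_l; [apply Rabs_pos|exact A]).
apply Rabs_le_between in H1; apply Rabs_le_between in H2; lra.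
Qed.

Lemma ex_series_alt_term (q : R) (s W : C) (d c : nat) :
  (0 < q < 1)%R -> W <> 0 -> (0 < d)%nat ->
  ex_series (K := C_AbsRing) (V := C_NormedModule)
    (fun n => alt_term q s W (d * n + c)).
Proof.
intros Hq HW Hd.
destruct (alt_term_bound q s W Hq HW) as [K [HK HB]].
apply (ex_series_le (K := C_AbsRing) (V := C_CompleteNormedModule) _
  (fun n => (K * q ^ n)%R)).
- intros n; change norm with Cmod.
  eapply Rle_trans; [apply HB|].
  apply Rmult_le_compat_l; [exact HK|].
  (* [n <= d n + c] because [d > 0] *)
  replace (d * n + c)%nat with (n + ((d - 1) * n + c))%nat by nia.
  assert (H1 : (q ^ ((d - 1) * n + c) <= 1)%R)
    by (rewrite <- (pow1 ((d - 1) * n + c)); apply pow_incr; lra).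
  assert (Hn : (0 <= q ^ n)%R) by (apply pow_le; lra).
  rewrite pow_add; nra.
- apply (ex_series_scal_l (K := R_AbsRing) (V := R_NormedModule)).
  apply ex_series_geom; rewrite Rabs_pos_eq; lra.
Qed.

(** * Reduction of the q-zeta values to the alternating series *)

Lemma RtoC_neq (u v : R) : u <> v -> RtoC u <> RtoC v.
Proof.
intros H E; now apply H, RtoC_inj.
Qed.

Lemma pow_lt_1 (q : R) (n : nat) :
  (0 < q < 1)%R -> (0 < n)%nat -> (0 < q ^ n < 1)%R.
Proof.
intros Hq Hn; split; [apply pow_lt; lra|].
apply pow_lt_1_compat; [lra|exact Hn].
Qed.

Lemma pow_opp_1_odd (n : nat) : Nat.Odd n -> ((-1) ^ n = -1)%R.
Proof.
intros [k ->]; rewrite Nat.add_1_r; apply pow_1_odd.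
Qed.

Lemma qzeta_arg_shift (q : R) (a b i n : nat) (x : C) :
  (0 < q < 1)%R -> (0 < a)%nat ->
  qzeta_arg q a b i x + pnum (q ^ a) (INR n)
  = RtoC (/ (q ^ (b * i) * ((1 - q ^ a) / (1 - q))))
    * ((Rcpow q (- (INR a * INR b * x)) - RtoC (q ^ (a * n + b * i)))
       / (1 - RtoC q)).
Proof.
intros Hq Ha.
assert (HA := pow_lt_1 q a Hq Ha).
assert (HQ : (0 < q ^ (b * i))%R) by (apply pow_lt; lra).
assert (Ha' : RtoC (INR a) <> 0) by (apply RtoC_neq, not_0_INR; lia).
rewrite pnum_INR by exact HA.
unfold qzeta_arg, pnum.
rewrite Rcpow_inv_base, Rcpow_pow_base by lra.
replace (INR a * - (INR b * x + INR b * INR i / INR a))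
  with (- (INR a * INR b * x) + - INR (b * i))
  by (rewrite mult_INR, RtoC_mult; field; exact Ha').
rewrite Rcpow_plus, (Rcpow_opp q (INR (b * i))), Rcpow_INR by lra.
rewrite pow_add, (pow_mult q a n).
generalize dependent (q ^ (b * i))%R; intros Q HQ.
generalize (Rcpow q (- (INR a * INR b * x))) as W; intros W.
generalize dependent (q ^ a)%R; intros A HA.
assert (RtoC A <> 0 /\ RtoC Q <> 0 /\ 1 - RtoC A <> 0 /\ 1 - RtoC q <> 0
        /\ RtoC A - 1 <> 0)
  as (N1 & N2 & N3 & N4 & N5).
{ repeat split; rewrite <- ?RtoC_minus; apply RtoC_neq; lra. }
assert (Hr : (0 < (1 - A) / (1 - q))%R) by (apply Rdiv_lt_0_compat; lra).
rewrite (RtoC_inv (Q * _)), (RtoC_mult Q), (RtoC_div (1 - A) (1 - q)),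
  (RtoC_div (1 - A ^ n)) by nra.
rewrite !RtoC_minus, (RtoC_inv A), (RtoC_mult (A ^ n)) by lra.
field.
repeat split; assumption.
Qed.

(** The power [s] of the factor [q^(- b i) / [a]_q] is what turns the weight
    [q^(i b (1 - s))] into [q^(b i)] and produces [[a]_q ^ s]; nonvanishing of
    the remaining factor, needed to split the power, is where the hypothesis
    that the q-zeta value is defined enters. *)
Lemma weighted_qzeta (q : R) (a b i : nat) (s x : C) :
  (0 < q < 1)%R -> (0 < a)%nat -> Nat.Odd a -> Nat.Odd b ->
  qzeta_defined (q ^ a) (qzeta_arg q a b i x) ->
  RtoC ((-1) ^ i) * Rcpow q (INR i * INR b * (1 - s))
    * qzeta (q ^ a) s (qzeta_arg q a b i x)
  = Ccpow (pnum q (INR a)) s * pnum (q ^ a) 2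
    * CSeries (fun n =>
        alt_term q s (Rcpow q (- (INR a * INR b * x))) (a * n + b * i)).
Proof.
intros Hq Ha Oa Ob Hdef.
set (W := Rcpow q (- (INR a * INR b * x))).
assert (HA := pow_lt_1 q a Hq Ha).
assert (Hr : (0 < (1 - q ^ a) / (1 - q))%R) by (apply Rdiv_lt_0_compat; lra).
rewrite pnum_INR, Ccpow_RtoC by assumption.
set (r := ((1 - q ^ a) / (1 - q))%R) in *.
assert (HQ : (0 < q ^ (b * i))%R) by (apply pow_lt; lra).
set (Q := (q ^ (b * i))%R) in *.
assert (HW : W <> 0) by apply Cexp_neq_0.
destruct (ex_series_alt_term q s W a (b * i) Hq HW Ha) as [L HL].
rewrite (CSeries_unique _ _ HL).
assert (HQr : (0 < / (Q * r))%R) by (apply Rinv_0_lt_compat; nra).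
assert (NQs := Cexp_neq_0 (s * RtoC (ln Q)) : Rcpow Q s <> 0).
assert (Nr := Cexp_neq_0 (s * RtoC (ln r)) : Rcpow r s <> 0).
assert (Nqr := Cexp_neq_0 (s * RtoC (ln (/ (Q * r)))) : Rcpow (/ (Q * r)) s <> 0).
assert (Hpow : Rcpow (/ (Q * r)) s = / (Rcpow Q s * Rcpow r s)).
{ rewrite Rcpow_inv_base, Rcpow_opp, Rcpow_mult_base by nra; reflexivity. }
assert (Hweight : Rcpow q (INR i * INR b * (1 - s)) = RtoC Q / Rcpow Q s).
{ unfold Q at 2; rewrite Rcpow_pow_base by lra.
  unfold Q, Cdiv; rewrite <- Rcpow_INR, <- Rcpow_opp, <- Rcpow_plus by lra.
  f_equal; rewrite mult_INR, RtoC_mult; ring. }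
assert (NRQ : RtoC Q <> 0) by (apply RtoC_neq; lra).
assert (Hsign : RtoC ((-1) ^ i) * RtoC ((-1) ^ i) = 1).
{ rewrite <- RtoC_mult, <- Rpow_mult_distr.
  replace (-1 * -1)%R with 1%R by ring; now rewrite pow1. }
assert (Hterm : forall n,
  RtoC ((-1) ^ n * (q ^ a) ^ n)
    / Ccpow (qzeta_arg q a b i x + pnum (q ^ a) (INR n)) s
  = RtoC ((-1) ^ i) * (Rcpow Q s * Rcpow r s) / RtoC Q
    * alt_term q s W (a * n + b * i)).
{ intros n.
  assert (Hz : qzeta_arg q a b i x + pnum (q ^ a) (INR n) <> 0).
  { intros H; apply (Hdef n).
    replace (qzeta_arg q a b i x) with
      (qzeta_arg q a b i x + pnum (q ^ a) (INR n) - pnum (q ^ a) (INR n))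
      by ring.
    rewrite H; ring. }
  rewrite qzeta_arg_shift in Hz |- * by assumption.
  fold W Q r in Hz |- *.
  unfold alt_term.
  set (z := (W - RtoC (q ^ (a * n + b * i))) / (1 - RtoC q)) in *.
  assert (Nz : z <> 0) by (intros H; apply Hz; rewrite H; ring).
  assert (Np := Cexp_neq_0 (s * Clog z) : Ccpow z s <> 0).
  rewrite Ccpow_scale_pos, Hpow by assumption.
  replace ((- q) ^ (a * n + b * i))%R
    with ((-1) ^ i * ((-1) ^ n * (q ^ a) ^ n) * Q)%R.
  2:{ replace (- q)%R with (-1 * q)%R by ring.
      rewrite Rpow_mult_distr, !pow_add, (pow_mult (-1) a), (pow_mult (-1) b).
      rewrite (pow_opp_1_odd a Oa), (pow_opp_1_odd b Ob), (pow_mult q a).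
      unfold Q; ring. }
  rewrite (RtoC_mult _ Q), (RtoC_mult ((-1) ^ i)).
  transitivity (RtoC ((-1) ^ i) * RtoC ((-1) ^ i)
    * (RtoC ((-1) ^ n * (q ^ a) ^ n) / (/ (Rcpow Q s * Rcpow r s) * Ccpow z s))).
  - rewrite Hsign; ring.
  - field; repeat split; assumption. }
unfold qzeta.
rewrite (CSeries_unique _ (RtoC ((-1) ^ i) * (Rcpow Q s * Rcpow r s) / RtoC Q * L)).
2:{ eapply is_series_ext; [intros n; symmetry; apply Hterm|].
    apply (is_series_scal (K := C_AbsRing) (V := C_NormedModule)); exact HL. }
rewrite Hweight.
transitivity (RtoC ((-1) ^ i) * RtoC ((-1) ^ i) * (Rcpow r s * pnum (q ^ a) 2 * L)).
- field; repeat split; assumption.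
- rewrite Hsign; ring.
Qed.

Theorem theorem2 :
  forall (q : R) (a b : nat) (s x : C),
    (0 < q < 1)%R ->
    (0 < a)%nat -> Nat.Odd a ->
    (0 < b)%nat -> Nat.Odd b ->
    (forall i : nat, (i < a)%nat ->
       qzeta_defined (q ^ a) (qzeta_arg q a b i x)) ->
    (forall i : nat, (i < b)%nat ->
       qzeta_defined (q ^ b) (qzeta_arg q b a i x)) ->
    pnum (q ^ b) 2 / Ccpow (pnum q (INR a)) s *
      sum_n (G := C_AbelianMonoid)
        (fun i => RtoC ((-1) ^ i) * Rcpow q (INR i * INR b * (1 - s)) *
                  qzeta (q ^ a) s (qzeta_arg q a b i x)) (a - 1)
    = pnum (q ^ a) 2 / Ccpow (pnum q (INR b)) s *
      sum_n (G := C_AbelianMonoid)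
        (fun i => RtoC ((-1) ^ i) * Rcpow q (INR i * INR a * (1 - s)) *
                  qzeta (q ^ b) s (qzeta_arg q b a i x)) (b - 1).
Proof.
intros q a b s x Hq Ha Oa Hb Ob Hdefa Hdefb.
rewrite (sum_n_ext_loc (G := C_AbelianMonoid) _ _ (a - 1)
  (fun i Hi => weighted_qzeta q a b i s x Hq Ha Oa Ob (Hdefa i ltac:(lia)))).
rewrite (sum_n_ext_loc (G := C_AbelianMonoid) _ _ (b - 1)
  (fun i Hi => weighted_qzeta q b a i s x Hq Hb Ob Oa (Hdefb i ltac:(lia)))).
replace (INR b * INR a * x) with (INR a * INR b * x) by ring.
set (W := Rcpow q (- (INR a * INR b * x))).
rewrite !sum_n_Cmult_l.
rewrite (double_sum_sym (alt_term q s W) a b Ha Hb).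
- field; split; apply Cexp_neq_0.
- intros d c Hd; apply ex_series_alt_term; [exact Hq|apply Cexp_neq_0|exact Hd].
Qed.
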